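(* Let $X$ be any topological space and let $\upsilon^c X$ be the space described in the context. Then $\upsilon^c X$ is a $c_c$-realcompact space that contains $X$ as a dense subspace and has the following extension property: each continuous map from $X$ into a regular $c_c$-realcompact space $Y$ can be extended to a continuous map from $\upsilon^c X$ into $Y$. Moreover, $X$ is $c_c$-realcompact if and only if $X=\upsilon^c X$.
   Context: $C(X,\mathbb{Z})$ is the set of continuous functions $X\to\mathbb{Z}$, where $\mathbb{Z}$ has the discrete topology. A family $\mathcal{F}$ of subsets of a topological space $X$ is $c$-stable if for every $f\in C(X,\mathbb{Z})$ there exists $F\in\mathcal{F}$ such that $f$ is bounded on $F$. A topological space $X$ (not necessarily completely regular) is $c_c$-realcompact if every $c$-stable family of closed sets in $X$ with the finite intersection property has nonempty intersection. The space $\upsilon^c X$: for $x\in X$ let $\mathcal{G}^x$ be the family of all closed sets in $X$ that contain $x$. The set $X$ is enlarged to a set $\upsilon^c X\supseteq X$ so that $\upsilon^c X\setminus X$ is an index set, via a bijection $p\mapsto\mathcal{G}^p$, for the collection of all maximal $c$-stable families of closed subsets of $X$ with the finite intersection property but with empty intersection. For each closed set $F$ in $X$ put $\bar{F}=\{p\in\upsilon^c X: F\in\mathcal{G}^p\}$. The topology of $\upsilon^c X$ is the one for which $\{\bar{F}: F \text{ closed in } X\}$ is a base for the closed sets (every closed set is an intersection of sets of this form). *)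

(* Defs.v *)
From HB Require Import structures.
From mathcomp Require Import all_boot all_order all_algebra finmap.
From mathcomp Require Import all_classical topology separation_axioms.
Set Implicit Arguments.
Unset Strict Implicit.
Unset Printing Implicit Defensive.
Import Order.TTheory GRing.Theory Num.Theory.
Local Open Scope classical_set_scope.
Local Open Scope ring_scope.

Section c_stable.
Variable X : topologicalType.
Implicit Types (f : X -> int) (F : set X) (S G : set (set X)).

Definition CZ : set (X -> int) :=
  [set f | continuous (f : X -> discrete_topology int)].

Definition int_bounded_on f F := exists M : int, forall x, F x -> `|f x| <= M.

Definition c_stable S :=
  forall f, CZ f -> exists2 F, S F & int_bounded_on f F.

(* finI S id: every finite subfamily of S has a nonempty intersection *)
Definition fip S := finI S id.

Definition c_stable_closed_fip S := [/\ S `<=` closed, c_stable S & fip S].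

Definition cc_realcompact :=
  forall S, c_stable_closed_fip S -> \bigcap_(F in S) F !=set0.

Definition maximal_c_stable_closed_fip G :=
  c_stable_closed_fip G /\
  forall S, c_stable_closed_fip S -> G `<=` S -> S = G.

End c_stable.

Section upsilon.
Variable X : topologicalType.

(* The points of upsilon_c X outside X are the maximal families themselves,
   so the indexing bijection p |-> G^p is the identity. *)
Definition upsilon_index : Type :=
  {G : set (set X) |
    maximal_c_stable_closed_fip G /\ \bigcap_(F in G) F = set0}.

Definition upsilon_c : Type := (X + upsilon_index)%type.

Definition upsilon_incl (x : X) : upsilon_c := inl x.

Definition upsilon_family (p : upsilon_c) : set (set X) :=
  match p with
  | inl x => [set F | closed F /\ F x]
  | inr G => sval G
  end.

Definition upsilon_bar (F : set X) : set upsilon_c :=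
  [set p | upsilon_family p F].

(* U is open iff its complement is an intersection of sets upsilon_bar F:
   these sets form a base for the closed sets. *)
Definition upsilon_open (U : set upsilon_c) : Prop :=
  exists2 S : set (set X), S `<=` closed &
    ~` U = \bigcap_(F in S) upsilon_bar F.

Lemma maximal_mem (G : set (set X)) (A : set X) :
  maximal_c_stable_closed_fip G -> closed A ->
  (forall D : {fset (set X)}, {subset D <= G} ->
     (A `&` \bigcap_(F in [set` D]) F) !=set0) -> G A.
Proof.
move=> [[Gcl Gst Gfip] Gmax] cA AG.
rewrite -(Gmax (A |` G)); [by left| |by move=> F GF; right].
split.
- by move=> F [->//|/Gcl].
- by move=> f /Gst[F GF bF]; exists F => //; right.
- move=> D DAG; have [|x [Ax Dx]] := AG (D `\ A)%fset.
    move=> F; rewrite !inE => /andP[FA /DAG/set_mem [FA'|GF]].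
      by rewrite FA' eqxx in FA.
    exact: GF.
  exists x => F FD; have [->//|FA] := eqVneq F A.
  by apply: Dx; rewrite /= !inE FA.
Qed.

Lemma maximal_prime (G : set (set X)) (A B : set X) :
  maximal_c_stable_closed_fip G -> closed A -> closed B ->
  G (A `|` B) <-> G A \/ G B.
Proof.
move=> mG cA cB; have [[Gcl Gst Gfip] _] := mG.
have up C K : closed K -> C `<=` K -> G C -> G K.
  move=> cK CK GC; apply: maximal_mem => // D DG.
  have [|x Dx] := Gfip (C |` D)%fset.
    by move=> F; rewrite !inE => /orP[/eqP->//|/DG/set_mem].
  exists x; split; first by apply/CK/(Dx C); rewrite /= !inE eqxx.
  by move=> F FD; apply: Dx; rewrite /= !inE FD orbT.
split; last first.
  by case; apply: up; [exact: closedU|move=> ? ?; left|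
                       exact: closedU|move=> ? ?; right].
move=> GAB; have [GA|nGA] := pselect (G A); first by left.
right; apply: maximal_mem => // D DG; apply/not_existsP => nBD.
apply: nGA; apply: maximal_mem => // E EG.
have [|x Hx] := Gfip ((A `|` B)%classic |` (D `|` E))%fset.
  by move=> F; rewrite !inE => /or3P[/eqP->//|/DG/set_mem|/EG/set_mem].
have DEx F : (F \in D) || (F \in E) -> F x.
  by move=> DE; apply: Hx; rewrite /= !inE DE orbT.
have [Ax|Bx] : (A `|` B) x by apply: (Hx (A `|` B)); rewrite /= !inE eqxx.
  by exists x; split=> // F /= FE; apply: DEx; rewrite FE orbT.
by case: (nBD x); split=> // F /= FD; apply: DEx; rewrite FD.
Qed.

Lemma upsilon_bar0 : upsilon_bar set0 = set0.
Proof.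
apply/seteqP; split=> [[x []//|[G [[[_ _ Gfip] _] _]]] /= G0|//].
have [|x] := Gfip [fset set0]%fset; last first.
  by move=> /(_ set0); apply; rewrite /= inE.
by move=> F /fset1P ->; exact/mem_set.
Qed.

Lemma upsilon_barU (A B : set X) : closed A -> closed B ->
  upsilon_bar (A `|` B) = upsilon_bar A `|` upsilon_bar B.
Proof.
move=> cA cB; apply/seteqP; split=> [[x|[G [mG /= _]]] | [x|[G [mG /= _]]]].
- by move=> [_ [Ax|Bx]]; [left|right].
- by move/(maximal_prime mG cA cB).
- by move=> [[_ Ax]|[_ Bx]]; (split; first exact: closedU); [left|right].
- by move=> ?; apply/(maximal_prime mG cA cB).
Qed.

Lemma upsilon_openT : upsilon_open setT.
Proof.
exists [set set0]; first by move=> _ ->; exact: closed0.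
by rewrite bigcap_set1 upsilon_bar0 setCT.
Qed.

Lemma upsilon_openI : setI_closed upsilon_open.
Proof.
move=> U V [S Scl US] [T Tcl VT].
exists [set A `|` B | A in S & B in T].
  by move=> _ [A SA [B TB <-]]; apply: closedU; [exact: Scl|exact: Tcl].
rewrite setCI US VT; apply/seteqP; split=> p.
  by move=> H _ [A SA [B TB <-]]; rewrite upsilon_barU; [|exact: Scl|exact: Tcl];
     case: H => H; [left; exact: H|right; exact: H].
move=> H; apply: contrapT => /not_orP[/existsNP[A /not_implyP[SA nA]]].
move=> /existsNP[B /not_implyP[TB nB]].
have : upsilon_bar (A `|` B) p by apply: H; exists A => //; exists B.
by rewrite upsilon_barU; [case|exact: Scl|exact: Tcl].
Qed.

Lemma upsilon_open_bigU (I : Type) (f : I -> set upsilon_c) :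
  (forall i, upsilon_open (f i)) -> upsilon_open (\bigcup_i f i).
Proof.
move=> fop.
exists [set F | closed F /\ exists i, ~` f i `<=` upsilon_bar F].
  by move=> F [].
rewrite setC_bigcup; apply/seteqP; split=> p H.
  by move=> F [_ [i]]; apply; exact: H.
move=> i _; have [S Scl fS] := fop i; rewrite fS => F SF.
by apply: H; split; [exact: Scl|exists i; rewrite fS => q; exact].
Qed.

HB.instance Definition _ := gen_eqMixin upsilon_c.
HB.instance Definition _ := gen_choiceMixin upsilon_c.
HB.instance Definition _ :=
  isOpenTopological.Build upsilon_c upsilon_openT upsilon_openI
    upsilon_open_bigU.

Lemma upsilon_openE : @open upsilon_c = upsilon_open.
Proof. by []. Qed.

End upsilon.

Definition topological_embedding (X Y : topologicalType) (f : X -> Y) :=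
  injective f /\ open = [set f @^-1` U | U in open].

(* Main.v *)
(** Each family G^p (p in upsilon_c X) is a prime, upward closed, c-stable family
    of closed sets with the finite intersection property. Given f : X -> Y, the
    closed K in Y with f^-1 K in G^p form a c-stable family with the finite
    intersection property; g(p) is any point common to them, and regularity of Y
    together with primality of G^q makes g continuous. In particular integer-valued
    functions extend, so for a c-stable family S on upsilon_c X the closed F in X
    whose bar contains a member of S form a c-stable family on X. A maximal family
    containing it is, or has in its intersection, a point common to all of S. *)
Require Import Defs.
From mathcomp Require Import all_boot all_order all_algebra finmap.
From mathcomp Require Import zify.
From mathcomp Require Import all_classical topology separation_axioms.
Local Open Scope classical_set_scope.

Lemma discrete_preimage_closed {X : topologicalType} {Y : discreteTopologicalType}
    (f : X -> Y) (A : set Y) :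
  continuous f -> closed (f @^-1` A).
Proof.
move=> fc; rewrite -[A]setCK -preimage_setC; apply: open_closedC.
by apply: (continuousP f).1 => //; exact: discrete_open.
Qed.

(** * The families attached to the points of [upsilon_c X] *)

Section families.
Context {X : topologicalType}.
Implicit Types (A B F K : set X) (S G : set (set X)) (p : upsilon_c X) (x : X).

Lemma fip_mono S G : S `<=` G -> fip G -> fip S.
Proof. by move=> SG Gf D DS; apply: Gf => F /DS /set_mem /SG /mem_set. Qed.

Lemma upsilon_family_closed p : upsilon_family p `<=` closed.
Proof. by case: p => [x F []|[G [[[Gcl Gs Gf] Gm] Ge]]]. Qed.

Lemma upsilon_family_up p F K : closed K -> F `<=` K ->
  upsilon_family p F -> upsilon_family p K.
Proof.
move=> cK FK pF; have cF := upsilon_family_closed p F pF.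
rewrite -[upsilon_family p K]/(upsilon_bar K p) -(setUidr FK).
by rewrite upsilon_barU //; left.
Qed.

Lemma upsilon_family_prime p A B : closed A -> closed B -> A `|` B = setT ->
  upsilon_family p setT -> ~ upsilon_family p A -> upsilon_family p B.
Proof.
move=> cA cB AB; rewrite -AB => pT npA.
have : upsilon_bar (A `|` B) p by [].
by rewrite upsilon_barU // => -[].
Qed.

Lemma upsilon_family_c_stable p : c_stable (upsilon_family p).
Proof.
case: p => [x|[G [[[Gcl Gs Gf] Gm] Ge]]]; last exact: Gs.
(* Points of [X] need not be closed, hence the closure; [f] is constant on it because its fibres are
   closed. *)
move=> f fc; exists (closure [set x]).
  by split; [exact: closed_closure|exact: subset_closure].
exists `|f x|%R => y yx.
have : (f @^-1` [set f x]) y; last by move=> /= ->.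
suff : closed (f @^-1` [set f x]).
  by rewrite closure_id => ->; move: yx; apply: closure_subset => _ ->.
exact: (discrete_preimage_closed (f : X -> discrete_topology int)).
Qed.

Lemma upsilon_family_fip p : fip (upsilon_family p).
Proof.
case: p => [x|[G [[[Gcl Gs Gf] Gm] Ge]]]; last exact: Gf.
by move=> D DG; exists x => F /DG/set_mem[].
Qed.

(** Stability applied to a constant function supplies a member, and [setT] lies above it. *)
Lemma upsilon_familyT p : upsilon_family p setT.
Proof.
have [|F pF _] := upsilon_family_c_stable p (fun=> 0%R).
  exact: cst_continuous.
by apply: upsilon_family_up pF => //; exact: closedT.
Qed.

Lemma upsilon_bar_closed F : closed F -> closed (upsilon_bar F).
Proof.
move=> cF; rewrite -openC upsilon_openE; exists [set F]; first by move=> _ ->.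
by rewrite setCK bigcap_set1.
Qed.

Lemma upsilon_closedP (C : set (upsilon_c X)) p : closed C ->
  (forall F, closed F -> C `<=` upsilon_bar F -> upsilon_bar F p) -> C p.
Proof.
rewrite -openC upsilon_openE => -[S Scl]; rewrite setCK => -> H F SF.
by apply: H => [|q]; [exact: Scl|exact].
Qed.

(** * Extension to maximal families by Zorn's lemma *)

Lemma total_on_bigcup_fip (C : set (set (set X))) :
  total_on C subset -> C !=set0 -> (forall S, C S -> fip S) ->
  fip (\bigcup_(S in C) S).
Proof.
move=> Ctot [A0 CA0] Cfip D DC.
(* In a chain, a finite subfamily of the union already lies in one member. *)
suff [A CA DA] : exists2 A, C A & {subset D <= A} by exact: Cfip DA.
elim/fset1U_rect: D DC => [|F D _ IH] DC; first by exists A0.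
have [|A CA DA] := IH; first by move=> K KD; apply: DC; rewrite !inE KD orbT.
have /set_mem[B CB BF] := DC F (fset1U1 F D).
have [AB|BA] := Ctot A B CA CB.
  exists B => // K; rewrite !inE => /orP[/eqP->//|/DA/set_mem/AB //].
exists A => // K; rewrite !inE => /orP[/eqP->|/DA/set_mem //].
exact: BA.
Qed.

(** Any family containing a c-stable one is c-stable, so the Zorn argument only has to preserve
    closedness and the finite intersection property. *)
Lemma maximal_extension S : c_stable_closed_fip S ->
  exists2 G, maximal_c_stable_closed_fip G & S `<=` G.
Proof.
move=> [Scl Ss Sf].
(* With S adjoined inside the predicate, the empty chain needs no exception. *)
have [C CC Ctot|A [[Acl Af] Amax]] :=
    @Zorn_bigcup (set X) [set A | A `<=` closed /\ fip (S `|` A)].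
  split=> [F [A /CC[Acl _]]|]; first exact: Acl.
  (* Adding [set0] makes the chain nonempty and brings [S] itself into the union. *)
  apply: (@fip_mono _ (\bigcup_(A in [set S `|` A | A in set0 |` C]) A)).
    move=> F [SF|[A CA AF]]; first by exists (S `|` set0); [exists set0 => //; left|left].
    by exists (S `|` A); [exists A => //; right|right].
  apply: total_on_bigcup_fip.
  - move=> _ _ [A [->|CA] <-] [B [->|CB] <-]; [left|left|right|].
    + by [].
    + by rewrite setU0; exact: subsetUl.
    + by rewrite setU0; exact: subsetUl.
    + by have [AB|BA] := Ctot A B CA CB; [left|right]; exact: setUS.
  - by exists (S `|` set0), set0 => //; left.
  - by move=> _ [A [->|/CC[_ ?]] <-] //; rewrite setU0.
exists (S `|` A); last exact: subsetUl.
split.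
  split=> //; first by move=> F [/Scl|/Acl].
  by move=> f /Ss[F SF bF]; exists F => //; left.
move=> G [Gcl Gs Gf] SAG; apply/seteqP; split=> // F GF; apply: contrapT => nF.
apply: (Amax G); last by split=> //; apply: fip_mono Gf => K [SK|//]; apply: SAG; left.
split=> [|GA]; last by apply: nF; right; exact: GA.
by move=> K AK; apply: SAG; right.
Qed.

End families.

(** * Extension of continuous maps *)

Lemma continuous_extension {X Y : topologicalType} (f : X -> Y) :
  regular_space Y -> cc_realcompact Y -> continuous f ->
  exists2 g : upsilon_c X -> Y, continuous g &
    forall x : X, g (upsilon_incl x) = f x.
Proof.
move=> Yreg Ycc fc.
have fcl K : closed K -> closed (f @^-1` K) by apply: (continuous_closedP f).1.
pose H p := [set K | closed K /\ upsilon_family p (f @^-1` K)].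
have Hcc p : exists y, (\bigcap_(K in H p) K) y.
  apply: Ycc; split=> [K []//|h hc|D DH].
    have [|F pF [M FM]] := upsilon_family_c_stable p (h \o f).
      by move=> x; apply: continuous_comp; [exact: fc|exact: hc].
    have cM : closed [set y | `|h y| <= M]%R.
      exact: (discrete_preimage_closed (h : Y -> discrete_topology int)
        [set n | `|n| <= M]%R).
    exists [set y | `|h y| <= M]%R; last by exists M.
    by split=> //; apply: upsilon_family_up pF => //; exact: fcl.
  have [|x Hx] := upsilon_family_fip p [fset f @^-1` K | K in D]%fset.
    by move=> _ /imfsetP[K /DH/set_mem[_ pK] ->]; exact/mem_set.
  by exists (f x) => K KD; apply: (Hx (f @^-1` K)); apply/imfsetP; exists K.
have /choice[g0 g0P] := Hcc.
(* [Y] need not be Hausdorff, so [g0] may differ from [f] on [X]; there [f x] is itself a common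
   point and is taken instead. *)
pose g p := if p is inl x then f x else g0 p.
have gP p : (\bigcap_(K in H p) K) (g p).
  by case: p => [x K [_ []]|i]; [|exact: g0P].
exists g => // p V /Yreg [W0 W0p W0V].
move: W0p; rewrite nbhsE => -[W [Wo Wp] WW0].
have cW : closed (~` W) by rewrite -openC setCK.
have np : ~ upsilon_bar (f @^-1` (~` W)) p.
  by move=> pW; apply: (gP p (~` W)) Wp.
(* Off this bar, primality puts the preimage of [closure W] in the family of [q], since the two
   preimages cover [X]; hence [g q] lies in [closure W]. *)
suff : nbhs p (~` upsilon_bar (f @^-1` (~` W))).
  apply: filterS => q nq; apply/W0V/(closure_subset WW0).
  apply: (gP q); split; first exact: closed_closure.
  apply: upsilon_family_prime nq.
  - exact: fcl.
  - by apply: fcl; exact: closed_closure.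
  - rewrite -preimage_setU -subTset => x _ /=.
    by have [/subset_closure|] := pselect (W (f x)); [right|left].
  - exact: upsilon_familyT.
have oN : open (~` upsilon_bar (f @^-1` (~` W))).
  by apply: closed_openC; apply: upsilon_bar_closed; exact: fcl.
exact: open_nbhs_nbhs (conj oN np).
Qed.

(** * Realcompactness of the integers and of [upsilon_c X] *)

Lemma finite_int_ball (M : int) : finite_set [set n : int | `|n| <= M]%R.
Proof.
apply: (@sub_finite_set _ _
  (Posz @` `I_(`|M|%N.+1) `|` Negz @` `I_(`|M|%N.+1))).
  by case=> n /= nM; [left|right]; exists n => //=; lia.
by rewrite finite_setU; split; apply: finite_image; exact: finite_II.
Qed.

(** The identity is bounded on some member, which is finite, hence compact; a cluster point of the
    generated filter lies in every closed member. *)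
Lemma discrete_int_cc_realcompact : cc_realcompact (discrete_topology int).
Proof.
move=> S [Scl Ss Sf].
have [//|F SF [M FM]] := Ss id; first by move=> x.
have Fcpt : compact F.
  by apply/finite_compact/(sub_finite_set _ (finite_int_ball M)) => n /FM.
have Sfil := finI_filter Sf.
have SS K : S K -> filter_from (finI_from S id) id K.
  by move=> SK; exists K => //; exact: finI_from1.
have [n [_ nS]] := Fcpt _ Sfil (SS _ SF).
by exists n => K SK; apply: Scl => //; move: nS; rewrite clusterE; apply; exact: SS.
Qed.

Lemma cc_realcompact_upsilon_c (X : topologicalType) : cc_realcompact (upsilon_c X).
Proof.
move=> S [Scl Ss Sf].
pose T := [set F : set X | closed F /\ exists2 A, S A & A `<=` upsilon_bar F].
have [|G mG TG] := @maximal_extension X T.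
  split=> [F []//|f fc|D DT].
    have [g gc gf] := continuous_extension (f : X -> discrete_topology int)
      (@uniform_regular _) discrete_int_cc_realcompact fc.
    have [A SA [M AM]] := Ss g gc.
    pose F := (f : X -> discrete_topology int) @^-1` [set n | `|n| <= M]%R.
    have cF : closed F by exact: discrete_preimage_closed.
    exists F; last by exists M.
    split=> //.
    exists A => // p Ap; apply: contrapT => npF.
    (* The set where [g] exceeds the bound is closed. If the bar of a closed [K] contains it, then
       [F] and [K] cover [X], so primality puts [p] in that bar. *)
    suff : (~` (g @^-1` [set n | `|n| <= M]%R)) p by apply; exact: AM.
    apply: upsilon_closedP => [|K cK gK].
      rewrite -openC setCK.
      by apply: (continuousP g).1 gc _ _; exact: discrete_open.
    apply: (@upsilon_family_prime _ _ F) => //.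
      rewrite -subTset => x _; have [|nFx] := pselect (F x); first by left.
      by right; have [] : upsilon_bar K (upsilon_incl x) by apply: gK; rewrite /= gf.
    exact: upsilon_familyT.
  have /choice[A AP] : forall F, exists A, F \in D -> S A /\ A `<=` upsilon_bar F.
    move=> F; have [/DT/set_mem[_ [A SA AF]]|_] := boolP (F \in D).
      by exists A.
    by exists set0.
  (* All of [D] belongs to the family of a point [p] common to the chosen sets, and that family has
     the finite intersection property. *)
  have [|p Ap] := Sf [fset A F | F in D]%fset.
    by move=> _ /imfsetP[F /= /AP[SA _] ->]; exact/mem_set.
  apply: (upsilon_family_fip p) => F FD; apply/mem_set.
  by apply: (AP F FD).2; apply: (Ap (A F)); apply/imfsetP; exists F.
have [[Gcl _ _] _] := mG.
have Sbar p : (forall F, G F -> upsilon_family p F) -> (\bigcap_(A in S) A) p.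
  move=> Gp A SA; apply: upsilon_closedP => [|F cF AF]; first exact: Scl.
  by apply/Gp/TG; split=> //; exists A.
(* Either [G] has a common point in [X], or [G] is itself an added point. *)
have [[x Gx]|/set0P/negP/negPn/eqP G0] := pselect (\bigcap_(F in G) F !=set0).
  by exists (upsilon_incl x); apply: Sbar => F GF; split; [exact: Gcl|exact: Gx].
by exists (inr (exist _ G (conj mG G0))); exact: Sbar.
Qed.

(** * Embedding, density and the case of no added points *)

Lemma upsilon_incl_embedding (X : topologicalType) :
  topological_embedding (@upsilon_incl X).
Proof.
split=> [x y []//|]; apply/seteqP; split=> [U oU|_ [V oV <-]].
  have cU : closed (~` U) by exact: open_closedC.
  exists (~` upsilon_bar (~` U)).
    by apply: closed_openC; exact: upsilon_bar_closed.
  apply/seteqP; split=> x; last by move=> Ux [_]; exact.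
  by move=> nUx; apply: contrapT => Ux; exact: nUx.
have [S Scl VS] : upsilon_open V by [].
rewrite -[X in open X]setCK; apply: closed_openC.
rewrite preimage_setC VS.
have -> : @upsilon_incl X @^-1` (\bigcap_(F in S) upsilon_bar F) = \bigcap_(F in S) F.
  apply/seteqP; split=> x H F SF; first by have [] := H F SF.
  by split; [exact: Scl|exact: H].
by apply: closed_bigI => F /Scl.
Qed.

(** If an open set misses [X], a bar containing its complement contains [X], so it comes from [setT]
    and is the whole space. *)
Lemma upsilon_incl_dense (X : topologicalType) : dense (range (@upsilon_incl X)).
Proof.
move=> U [p Up] oU; apply: contrapT => nUX.
suff : (~` U) p by exact.
apply: upsilon_closedP => [|F cF UF]; first exact: open_closedC.
suff -> : F = setT by exact: upsilon_familyT.
rewrite -subTset => x _; have [] // : upsilon_bar F (upsilon_incl x).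
by apply: UF => Ux; apply: nUX; exists (upsilon_incl x); split=> //; exists x.
Qed.

(** An added point is a family violating realcompactness; conversely, a violating family extends to
    a maximal one, which is an added point. *)
Lemma cc_realcompactP (X : topologicalType) :
  cc_realcompact X <-> range (@upsilon_incl X) = [set: upsilon_c X].
Proof.
split=> [Xcc|XT S Scc].
  rewrite -subTset => -[x|[G [mG G0]]] _; first by exists x.
  by have [x] := Xcc _ mG.1; rewrite [X in X x]G0.
have [G mG SG] := maximal_extension S Scc.
have [[x Gx]|/set0P/negP/negPn/eqP G0] := pselect (\bigcap_(F in G) F !=set0).
  by exists x => F /SG; exact: Gx.
have : range (@upsilon_incl X) (inr (exist _ G (conj mG G0))) by rewrite XT.
by case.
Qed.

Theorem theorem2p5 (X : topologicalType) :
  [/\ cc_realcompact (upsilon_c X),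
      topological_embedding (@upsilon_incl X) /\
        dense (range (@upsilon_incl X)),
      (forall (Y : topologicalType), regular_space Y -> cc_realcompact Y ->
        forall f : X -> Y, continuous f ->
        exists2 g : upsilon_c X -> Y, continuous g &
          forall x : X, g (upsilon_incl x) = f x)
    & cc_realcompact X <-> range (@upsilon_incl X) = [set: upsilon_c X]].
Proof.
split; [exact: cc_realcompact_upsilon_c|split| |exact: cc_realcompactP].
- exact: upsilon_incl_embedding.
- exact: upsilon_incl_dense.
- by move=> Y Yreg Ycc f; exact: continuous_extension.
Qed.
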